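(* If $A$ is almost everywhere dominating and $A\leq_T 0'$, then $A'\equiv_T 0''$.
   Context: $\mu$ is the fair-coin (Lebesgue) probability measure on $2^\omega$; ''almost all'' means on a set of $\mu$-measure $1$. For $f,g\in\omega^\omega$, $f$ dominates $g$ if $\exists m\,\forall n>m\,(f(n)>g(n))$. A set $A\in 2^\omega$ is almost everywhere (a.e.) dominating if for almost all $X\in 2^\omega$ and all functions $g\leq_T X$, there is a function $f\leq_T A$ such that $f$ dominates $g$. *)

(* Defs.v *)
From Stdlib Require Cantor.
From HB Require Import structures.
From mathcomp Require Import all_boot all_order all_algebra.
From mathcomp Require Import all_classical all_reals all_analysis.
From mathcomp Require Import lra.

Set Implicit Arguments.
Unset Strict Implicit.
Unset Printing Implicit Defensive.

Import Order.TTheory GRing.Theory Num.Theory.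
Import numFieldNormedType.Exports.

Local Open Scope classical_set_scope.
Local Open Scope ring_scope.

Definition pair_nat (x y : nat) : nat := Cantor.to_nat (x, y).

Arguments pair_nat : simpl never.

Lemma pair_nat_inj (x y z t : nat) :
  pair_nat x y = pair_nat z t -> x = z /\ y = t.
Proof. by move=> /Cantor.to_nat_inj[]. Qed.

(* Programs with an oracle, for partial functions from nat to nat; functions of
   several arguments are handled through pair_nat. *)
Inductive code : Type :=
| Zero
| Succ
| Fst
| Snd
| Oracle
| Pair of code & code
| Comp of code & code
| Prec of code & code
| Mu of code.

(* The graph of the function defined from [base] and [step] by primitive
   recursion, with parameter [x]. *)
Fixpoint prec_graph (base step : nat -> nat -> Prop) (x k y : nat) : Prop :=
  match k with
  | 0%N => base x y
  | k'.+1 => exists2 z, prec_graph base step x k' z &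
                        step (pair_nat x (pair_nat k' z)) y
  end.

(* [eval X c n y]: with the characteristic function of X as oracle, the program
   c halts on input n with output y. *)
Fixpoint eval (X : nat -> bool) (c : code) (n y : nat) : Prop :=
  match c with
  | Zero => y = 0%N
  | Succ => y = n.+1
  | Fst => y = (Cantor.of_nat n).1
  | Snd => y = (Cantor.of_nat n).2
  | Oracle => y = X n
  | Pair a b => exists u v, [/\ eval X a n u, eval X b n v & y = pair_nat u v]
  | Comp a b => exists2 z, eval X b n z & eval X a z y
  | Prec a b => prec_graph (eval X a) (eval X b)
                  (Cantor.of_nat n).1 (Cantor.of_nat n).2 y
  | Mu a => eval X a (pair_nat n y) 0 /\
            forall i, (i < y)%N -> exists v, eval X a (pair_nat n i) v.+1
  end.

(* A Goedel numbering of programs *)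
Fixpoint encode (c : code) : nat :=
  match c with
  | Zero => pair_nat 0 0
  | Succ => pair_nat 1 0
  | Fst => pair_nat 2 0
  | Snd => pair_nat 3 0
  | Oracle => pair_nat 4 0
  | Pair a b => pair_nat 5 (pair_nat (encode a) (encode b))
  | Comp a b => pair_nat 6 (pair_nat (encode a) (encode b))
  | Prec a b => pair_nat 7 (pair_nat (encode a) (encode b))
  | Mu a => pair_nat 8 (encode a)
  end.

Lemma encode_inj : injective encode.
Proof.
elim=> [|||||a IHa b IHb|a IHa b IHb|a IHa b IHb|a IHa]
  [|||||a' b'|a' b'|a' b'|a'] //= /pair_nat_inj[] // _.
- by move=> /pair_nat_inj[/IHa-> /IHb->].
- by move=> /pair_nat_inj[/IHa-> /IHb->].
- by move=> /pair_nat_inj[/IHa-> /IHb->].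
- by move=> /IHa->.
Qed.

(* The e-th partial function computable in X; it is nowhere defined when e is
   not the number of a program. *)
Definition Phi (X : nat -> bool) (e n y : nat) : Prop :=
  exists2 c, encode c = e & eval X c n y.

(* g <=_T X, for a total function g *)
Definition computable_in (X : nat -> bool) (g : nat -> nat) : Prop :=
  exists e, forall n, Phi X e n (g n).

(* A <=_T B, for sets *)
Definition turing_le (A B : nat -> bool) : Prop :=
  computable_in B (fun n => A n : nat).

Definition turing_equiv (A B : nat -> bool) : Prop :=
  turing_le A B /\ turing_le B A.

Definition jump (X : nat -> bool) : nat -> bool :=
  fun e => `[< exists y, Phi X e e y >].

Definition emptyset : nat -> bool := fun=> false.

Definition dominates (f g : nat -> nat) : Prop :=
  exists m, forall n, (m < n)%N -> (g n < f n)%N.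

Definition cylinder (s : seq bool) : set (nat -> bool) :=
  [set X | mkseq X (size s) = s].

(* [2^omega] with its Borel sigma-algebra *)
Notation cantor := (g_sigma_algebraType (range cylinder)).

Section fair_coin.
Context (R : realType).

(* The binary digits of x, for 0 <= x < 1 *)
Definition binary_digits (x : measurableTypeR R) : cantor :=
  fun n => odd (Num.truncn (2 ^+ n.+1 * x)).

Lemma binary_digit_preimage (n : nat) :
  [set x : R | odd (Num.truncn (2 ^+ n.+1 * x))] =
  \bigcup_(k in [set k | odd k])
    `[k%:R / 2 ^+ n.+1, k.+1%:R / 2 ^+ n.+1[%classic.
Proof.
have p2 : 0 < 2 ^+ n.+1 :> R by rewrite exprn_gt0.
apply/seteqP; split=> [x /= xodd|x [k /= kodd]].
- have x0 : 0 <= 2 ^+ n.+1 * x.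
    by case: leP => // x0; move: xodd; rewrite truncn_floor lt_geF.
  exists (Num.truncn (2 ^+ n.+1 * x)); first exact: xodd.
  by rewrite /= in_itv/= ler_pdivrMr// ltr_pdivlMr// [x * _]mulrC truncn_itv.
- rewrite in_itv/= ler_pdivrMr// ltr_pdivlMr// [x * _]mulrC => kx.
  by rewrite (truncn_def kx).
Qed.

Lemma measurable_binary_digit (n : nat) :
  measurable [set x : measurableTypeR R | odd (Num.truncn (2 ^+ n.+1 * x))].
Proof.
rewrite binary_digit_preimage; apply: bigcup_measurable => k _.
exact: measurable_itv.
Qed.

Lemma cylinder_rcons (s : seq bool) (b : bool) :
  cylinder (rcons s b) = cylinder s `&` [set X | X (size s) = b].
Proof.
apply/seteqP; split=> X; rewrite /cylinder/= size_rcons mkseqS.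
- by move/eqP; rewrite eqseq_rcons => /andP[/eqP-> /eqP->].
- by case=> -> ->.
Qed.

Lemma measurable_binary_digits : measurable_fun setT binary_digits.
Proof.
apply: (@measurability _ _ (measurableTypeR R) cantor setT binary_digits
  (range cylinder) erefl) => _ [_ [s _ <-] <-].
rewrite setTI; elim/last_ind: s => [|s b mE].
  by rewrite (_ : _ @^-1` _ = setT) //; apply/seteqP; split.
rewrite cylinder_rcons preimage_setI; apply: measurableI => //.
have := measurable_binary_digit (size s); case: b => //= mb.
rewrite (_ : _ @^-1` _ =
  ~` [set x : measurableTypeR R | odd (Num.truncn (2 ^+ (size s).+1 * x))]).
  exact: measurableC.
apply/seteqP; split=> x; rewrite /= /binary_digits; first by move=> ->.
by move=> /negP/negbTE.
Qed.

HB.instance Definition _ :=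
  isMeasurableFun.Build _ _ (measurableTypeR R) cantor binary_digits
    measurable_binary_digits.

(* The law of the binary digits of a random real uniformly distributed in
   [0, 1]. By fair_coin_cylinder below, this is the fair-coin measure. *)
Definition fair_coin : probability cantor R :=
  distribution (uniform_prob (@ltr01 R)) binary_digits.

Lemma binary_digits_cylinder (s : seq bool) :
  exists2 k : nat, (k < 2 ^ size s)%N & forall x : R, 0 <= x < 1 ->
    cylinder s (binary_digits x) <->
    k%:R <= 2 ^+ size s * x < k.+1%:R.
Proof.
elim/last_ind: s => [|s b [k k2 IH]].
  by exists 0%N => // x; rewrite expr0 mul1r.
exists (k.*2 + b)%N; rewrite size_rcons.
  rewrite expnS mul2n; case: b; rewrite ?addn0 ?addn1 ?ltn_double//.
  by rewrite ltn_Sdouble.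
move=> x x01; rewrite cylinder_rcons /=.
have [x0 _] := andP x01.
set y := 2 ^+ size s * x.
have y0 : 0 <= y by rewrite mulr_ge0// exprn_ge0.
have dE : binary_digits x (size s) = odd (Num.truncn (2 * y)).
  by rewrite /binary_digits exprS -mulrA.
rewrite exprS -mulrA -/y dE.
have kE (j : nat) : (j%:R <= y < j.+1%:R) = (Num.truncn y == j).
  by rewrite truncn_eq.
have jE (j : nat) : (j%:R <= 2 * y < j.+1%:R) = (Num.truncn (2 * y) == j).
  by rewrite truncn_eq// mulr_ge0.
have hE : Num.truncn y = (Num.truncn (2 * y))./2.
  apply/eqP; rewrite truncn_eq//.
  have /andP[] := @truncn_itv R (2 * y) (mulr_ge0 (ler0n _ 2) y0).
  rewrite -[X in X%:R <= _]odd_double_half -[X in _ < X.+1%:R]odd_double_half.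
  set h := _./2; rewrite -addSn !natrD -!mul2n !natrM.
  case: (odd _) => /= l1 l2; rewrite -natr1; apply/andP; split; lra.
rewrite jE; split.
- move=> [/(IH _ x01)]; rewrite -/y kE hE => /eqP <- <-.
  by rewrite addnC odd_double_half.
- move=> /eqP e; split; last by rewrite e oddD odd_double/= oddb.
  apply/(IH _ x01); rewrite -/y kE hE e.
  by rewrite addnC half_bit_double.
Qed.

Lemma fair_coin_cylinder (s : seq bool) :
  (fair_coin (cylinder s) = (2 ^- size s)%:E)%E.
Proof.
have [k k2 kE] := binary_digits_cylinder s.
have p2 : 0 < 2 ^+ size s :> R by rewrite exprn_gt0.
have mc : measurable (binary_digits @^-1` cylinder s).
  rewrite -[_ @^-1` _]setTI; apply: measurable_binary_digits => //.
  by apply: sub_sigma_algebra; exists s.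
set I := `[k%:R / 2 ^+ size s, k.+1%:R / 2 ^+ size s[%classic : set R.
have I01 x : I x -> 0 <= x < 1.
  rewrite /I/= in_itv/= => /andP[l u]; rewrite (le_trans _ l) ?divr_ge0//=.
  by rewrite (lt_le_trans u)// ler_pdivrMr// mul1r -natrX ler_nat.
have mI : measurable (I : set (measurableTypeR R)) by exact: measurable_itv.
have IE x : 0 <= x < 1 -> (binary_digits @^-1` cylinder s) x <-> I x.
  move=> x01; rewrite /I/= in_itv/= ler_pdivrMr// ltr_pdivlMr// [x * _]mulrC.
  exact: kE.
pose J : set R := (binary_digits @^-1` cylinder s).
have J1 : uniform_prob (@ltr01 R) J = lebesgue_measure (J `&` `[0, 1]).
  rewrite /uniform_prob integral_uniform_pdf.
  rewrite (eq_integral (cst 1%E)); last first.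
    move=> x; rewrite inE /= => -[_]; rewrite in_itv/= /uniform_pdf => ->.
    by rewrite subr0 invr1.
  rewrite integral_cst ?mul1e//; apply: measurableI => //.
rewrite /fair_coin /distribution /pushforward /= -/J J1.
have -> : J `&` `[0, 1] = I `|` (J `&` [set 1]).
  apply/seteqP; split=> x /=; rewrite ?in_itv/=.
    move=> [Jx /andP[x0]]; rewrite le_eqVlt => /orP[/eqP x1|x1].
      by right.
    by left; apply/IE => //; rewrite x0.
  move=> [Ix|[Jx x1]]; last by split=> //; rewrite x1 ler01 lexx.
  have x01 := I01 _ Ix; split; first exact/(IE _ x01).
  by case/andP: x01 => -> /ltW.
have mJ1 : measurable (J `&` [set 1] : set (measurableTypeR R)).
  exact: measurableI.
rewrite measureU0//; last first.
  apply/eqP; rewrite eq_le measure_ge0 andbT -(@lebesgue_measure_set1 R 1).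
  by apply: le_measure => //; rewrite ?inE//; exact: subIsetr.
transitivity (lebesgue_measure I) => //.
rewrite /I lebesgue_measure_itv/= lte_fin ltr_pM2r ?invr_gt0// ltr_nat ltnSn.
by rewrite -EFinB -mulrBl -natr1 addrAC subrr add0r mul1r.
Qed.

Definition ae_dominating (A : nat -> bool) : Prop :=
  {ae fair_coin, forall X : cantor, forall g : nat -> nat, computable_in X g ->
    exists2 f : nat -> nat, computable_in A f & dominates f g}.

End fair_coin.

(* Main.v *)
Require Import Defs.
From mathcomp Require Import all_boot all_order all_algebra.
From mathcomp Require Import all_classical all_reals all_analysis.
From HB Require Import structures.
From mathcomp Require Import zify lra.
From Stdlib Require Cantor.
(* Defs.eval has to shadow the evaluation map of function spaces. *)
Import Defs.

(* A Pi_2 question "is Q e t true for infinitely many t?", Q computable, is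
   coded into the behaviour of a random X as follows.  Reserve for every pair
   (e, t) a block of e + 2 bits of X, and let g(<e, t>) be the next t' > t with
   Q e t' if Q e t holds and block <e, t> of X consists of ones, and 0 otherwise.
   For each e, only the last t with Q e t can make g partial, so g is total, and
   hence computable in X, with probability at least 1/2.  If A is a.e.
   dominating, one function f computable in A therefore bounds g, from some
   fixed m on, for a set of X which is not null.  If Q e holds infinitely
   often, then f(<e, t>) must bound the next t' after all but finitely many of
   these t: otherwise the X bounded by f would avoid the ones on infinitely many
   disjoint blocks of the same length, an event of probability 0.  So "Q e holds
   infinitely often" is equivalent to the Sigma_2(A) statement "there is w with
   Q e w such that, for all t >= w with Q e t, some t' between t and f(<e, t>)
   satisfies Q e t'".  Being also Pi_2, it is decidable in A'.  The complement of
   0'' is of this form, by approximating 0' in stages. *)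

Set Implicit Arguments.
Unset Strict Implicit.
Unset Printing Implicit Defensive.

(** * Computable functions *)

Definition fst_nat (n : nat) : nat := (Cantor.of_nat n).1.
Definition snd_nat (n : nat) : nat := (Cantor.of_nat n).2.

Lemma fst_pair (x y : nat) : fst_nat (pair_nat x y) = x.
Proof. by rewrite /fst_nat /pair_nat Cantor.cancel_of_to. Qed.

Lemma snd_pair (x y : nat) : snd_nat (pair_nat x y) = y.
Proof. by rewrite /snd_nat /pair_nat Cantor.cancel_of_to. Qed.

Lemma pair_fst_snd (n : nat) : pair_nat (fst_nat n) (snd_nat n) = n.
Proof.
by rewrite /pair_nat /fst_nat /snd_nat -surjective_pairing Cantor.cancel_to_of.
Qed.

Definition pairE := (fst_pair, snd_pair).

Arguments fst_nat : simpl never.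
Arguments snd_nat : simpl never.

Lemma computable_inP (X : nat -> bool) (f : nat -> nat) :
  computable_in X f <-> exists c, forall n, eval X c n (f n).
Proof.
split=> [[e eP]|[c cP]]; last by exists (encode c) => n; exists c.
have [c ce _] := eP 0%N; exists c => n.
by have [c' c'e] := eP n; rewrite (encode_inj (etrans c'e (esym ce))).
Qed.

Lemma eval_inj (X : nat -> bool) (c : code) (n y z : nat) :
  eval X c n y -> eval X c n z -> y = z.
Proof.
elim: c n y z => [|||||a IHa b IHb|a IHa b IHb|a IHa b IHb|a IHa] n y z /=;
  do ?by move=> -> ->.
- by move=> [u [v [/IHa au /IHb bv ->]]] [u' [v' [/au -> /bv -> ->]]].
- by move=> [u /IHb bu au] [v /bu uv av]; apply: IHa au _; rewrite uv.
- elim: (Cantor.of_nat n).2 y z => [|k IH] y z /=; first exact: IHa.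
  by move=> [u /IH ku bu] [v /ku uv bv]; apply: IHb bu _; rewrite uv.
- move=> [y0 ylt] [z0 zlt]; case: (ltngtP y z) => // [/zlt|/ylt] [v av].
    by have := IHa _ _ _ y0 av.
  by have := IHa _ _ _ z0 av.
Qed.

Section Closure.
Variable X : nat -> bool.

Lemma computable_comp (f g : nat -> nat) :
  computable_in X f -> computable_in X g -> computable_in X (fun n => f (g n)).
Proof.
move=> /computable_inP[c cP] /computable_inP[d dP]; apply/computable_inP.
by exists (Comp c d) => n; exists (g n).
Qed.

Lemma computable_id : computable_in X (fun n => n).
Proof.
apply/computable_inP; exists (Pair Fst Snd) => n /=.
by exists (fst_nat n), (snd_nat n); split; rewrite ?pair_fst_snd.
Qed.

Lemma computable_pair (f g : nat -> nat) :
  computable_in X f -> computable_in X g ->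
  computable_in X (fun n => pair_nat (f n) (g n)).
Proof.
move=> /computable_inP[c cP] /computable_inP[d dP]; apply/computable_inP.
by exists (Pair c d) => n; exists (f n), (g n).
Qed.

Lemma computable_fst (f : nat -> nat) :
  computable_in X f -> computable_in X (fun n => fst_nat (f n)).
Proof.
by apply: computable_comp; apply/computable_inP; exists Fst.
Qed.

Lemma computable_snd (f : nat -> nat) :
  computable_in X f -> computable_in X (fun n => snd_nat (f n)).
Proof.
by apply: computable_comp; apply/computable_inP; exists Snd.
Qed.

Lemma computable_succ (f : nat -> nat) :
  computable_in X f -> computable_in X (fun n => (f n).+1).
Proof.
by apply: computable_comp; apply/computable_inP; exists Succ.
Qed.

Lemma computable_oracle (f : nat -> nat) :
  computable_in X f -> computable_in X (fun n => X (f n)).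
Proof.
by move=> fP; apply: (@computable_comp (fun n => X n : nat) f _ fP);
  apply/computable_inP; exists Oracle.
Qed.

Lemma computable_const (k : nat) : computable_in X (fun=> k).
Proof.
elim: k => [|k]; last exact: computable_succ.
by apply/computable_inP; exists Zero.
Qed.

Lemma computable_comp2 (F : nat -> nat -> nat) (f g : nat -> nat) :
  computable_in X (fun n => F (fst_nat n) (snd_nat n)) ->
  computable_in X f -> computable_in X g ->
  computable_in X (fun n => F (f n) (g n)).
Proof.
move=> FP fP gP.
have := computable_comp FP (computable_pair fP gP).
by under eq_fun do rewrite !pairE.
Qed.

Lemma computable_rect (b : nat -> nat) (s : nat -> nat -> nat -> nat)
    (x k : nat -> nat) :
  computable_in X b ->
  computable_in X (fun n => s (fst_nat n) (fst_nat (snd_nat n))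
                              (snd_nat (snd_nat n))) ->
  computable_in X x -> computable_in X k ->
  computable_in X (fun n => nat_rect (fun=> nat) (b (x n)) (s (x n)) (k n)).
Proof.
move=> /computable_inP[c cP] /computable_inP[d dP].
apply: (@computable_comp2
  (fun u v => nat_rect (fun=> nat) (b u) (s u) v)).
apply/computable_inP; exists (Prec c d) => n /=.
rewrite -/(fst_nat n) -/(snd_nat n).
elim: (snd_nat n) => //= j IH.
exists (nat_rect (fun=> nat) (b (fst_nat n)) (s (fst_nat n)) j) => //.
by have := dP (pair_nat (fst_nat n) (pair_nat j
  (nat_rect (fun=> nat) (b (fst_nat n)) (s (fst_nat n)) j))); rewrite !pairE.
Qed.

Lemma computable_iter (F : nat -> nat -> nat) (x y k : nat -> nat) :
  computable_in X (fun n => F (fst_nat n) (snd_nat n)) ->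
  computable_in X x -> computable_in X y -> computable_in X k ->
  computable_in X (fun n => iter (k n) (F (x n)) (y n)).
Proof.
move=> FP xP yP kP.
(* In [computable_rect] the start value depends on the parameter only, so the parameter carries both
   [x n] and [y n]. *)
have := @computable_rect snd_nat (fun u _ z => F (fst_nat u) z)
  (fun n => pair_nat (x n) (y n)) k
  (computable_snd computable_id) _ (computable_pair xP yP) kP.
have -> : (fun n => nat_rect (fun=> nat) (snd_nat (pair_nat (x n) (y n)))
   (fun _ z => F (fst_nat (pair_nat (x n) (y n))) z) (k n)) =
   (fun n => iter (k n) (F (x n)) (y n)).
  apply: funext => n; rewrite !pairE.
  by elim: (k n) => //= j ->.
apply; apply: computable_comp2 FP _ _.
  exact: computable_fst (computable_fst computable_id).
exact: computable_snd (computable_snd computable_id).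
Qed.

Lemma computable_pred (f : nat -> nat) :
  computable_in X f -> computable_in X (fun n => (f n).-1).
Proof.
move=> fP.
have := @computable_rect (fun=> 0%N) (fun _ j _ => j) f f
  (computable_const 0) (computable_fst (computable_snd computable_id)) fP fP.
by congr computable_in; apply: funext => n; case: (f n).
Qed.

Lemma computable_sub (f g : nat -> nat) :
  computable_in X f -> computable_in X g ->
  computable_in X (fun n => (f n - g n)%N).
Proof.
move=> fP gP.
have := @computable_iter (fun _ m => m.-1) (fun=> 0%N) f g
  (computable_pred (computable_snd computable_id)) (computable_const 0) fP gP.
congr computable_in; apply: funext => n.
by elim: (g n) => [|j /= ->]; rewrite ?subn0// subnS.
Qed.

Lemma computable_if (b : nat -> bool) (f g : nat -> nat) :
  computable_in X (fun n => b n) -> computable_in X f -> computable_in X g ->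
  computable_in X (fun n => if b n then f n else g n).
Proof.
move=> bP fP gP.
(* Recursion on the boolean read as 0 or 1: no step leaves [g n], one step replaces it by [f n]. *)
have := @computable_rect snd_nat (fun u _ _ => fst_nat u)
  (fun n => pair_nat (f n) (g n)) (fun n => b n)
  (computable_snd computable_id) (computable_fst (computable_fst computable_id))
  (computable_pair fP gP) bP.
by congr computable_in; apply: funext => n; case: (b n) => /=; rewrite !pairE.
Qed.

Lemma computable_negb (b : nat -> bool) :
  computable_in X (fun n => b n) -> computable_in X (fun n => ~~ b n).
Proof.
move=> bP.
have := @computable_if b (fun=> 0%N) (fun=> 1%N) bP
  (computable_const 0) (computable_const 1).
by congr computable_in; apply: funext => n; case: (b n).
Qed.

Lemma computable_andb (b d : nat -> bool) :
  computable_in X (fun n => b n) -> computable_in X (fun n => d n) ->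
  computable_in X (fun n => b n && d n).
Proof.
move=> bP dP.
have := @computable_if b (fun n => d n) (fun=> 0%N) bP dP (computable_const 0).
by congr computable_in; apply: funext => n; case: (b n).
Qed.

Lemma computable_orb (b d : nat -> bool) :
  computable_in X (fun n => b n) -> computable_in X (fun n => d n) ->
  computable_in X (fun n => b n || d n).
Proof.
move=> bP dP.
have := @computable_if b (fun=> 1%N) (fun n => d n) bP (computable_const 1) dP.
by congr computable_in; apply: funext => n; case: (b n).
Qed.

Lemma computable_implyb (b d : nat -> bool) :
  computable_in X (fun n => b n) -> computable_in X (fun n => d n) ->
  computable_in X (fun n => b n ==> d n).
Proof.
move=> bP dP.
have := @computable_if b (fun n => d n) (fun=> 1%N) bP dP (computable_const 1).
by congr computable_in; apply: funext => n; case: (b n).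
Qed.

Lemma computable_leq (f g : nat -> nat) :
  computable_in X f -> computable_in X g ->
  computable_in X (fun n => (f n <= g n)%N).
Proof.
move=> fP gP.
have := @computable_rect (fun=> 1%N) (fun _ _ _ => 0%N) (fun=> 0%N) _
  (computable_const 1) (computable_const 0) (computable_const 0)
  (computable_sub fP gP).
congr computable_in; apply: funext => n; rewrite -subn_eq0.
by case: (f n - g n)%N.
Qed.

Lemma computable_eqn (f g : nat -> nat) :
  computable_in X f -> computable_in X g ->
  computable_in X (fun n => f n == g n).
Proof.
move=> fP gP; under eq_fun do rewrite eqn_leq.
by apply: computable_andb; apply: computable_leq.
Qed.

Lemma computable_all_iota (P : nat -> nat -> bool) (x k : nat -> nat) :
  computable_in X (fun n => P (fst_nat n) (snd_nat n)) ->
  computable_in X x -> computable_in X k ->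
  computable_in X (fun n => all (P (x n)) (iota 0 (k n))).
Proof.
move=> PP xP kP.
have := @computable_rect (fun=> 1%N)
  (fun u j z => (P u j && (z == 1%N))%N) x k (computable_const 1) _ xP kP.
have -> : (fun n => nat_rect (fun=> nat) 1%N
    (fun j z => (P (x n) j && (z == 1%N)) : nat) (k n)) =
    (fun n => all (P (x n)) (iota 0 (k n))).
  apply: funext => n; elim: (k n) => // j IH.
  rewrite -[in RHS](addn1 j) iotaD all_cat /= IH add0n andbT andbC.
  by case: all.
apply; apply: computable_andb.
  apply: (@computable_comp2 (fun u v => P u v : nat)) PP _ _.
    exact: computable_fst computable_id.
  exact: computable_fst (computable_snd computable_id).
exact: computable_eqn (computable_snd (computable_snd computable_id))
  (computable_const 1).
Qed.

Lemma computable_ex_minn (P : nat -> nat -> bool)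
    (exP : forall n, exists i, P n i) :
  computable_in X (fun n => P (fst_nat n) (snd_nat n)) ->
  computable_in X (fun n => ex_minn (exP n)).
Proof.
(* [Mu] stops at the first value 0, so it is run on a program for the negation of [P]. *)
move=> /computable_negb /computable_inP[c cP]; apply/computable_inP.
exists (Mu c) => n /=; case: ex_minnP => i Pi imin; split=> [|j ji].
  by have := cP (pair_nat n i); rewrite !pairE Pi.
have := cP (pair_nat n j); rewrite !pairE.
have /negbTE-> : ~~ P n j by apply: contraL ji => /imin; rewrite -leqNgt.
by exists 0%N.
Qed.

End Closure.

Ltac computable := try assumption; lazymatch goal with
  | |- computable_in _ (fun=> ?k) => exact (computable_const _ k)
  | |- computable_in _ (fun n => n) => exact (computable_id _)
  | |- computable_in ?X fst_nat => exact (computable_fst (computable_id X))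
  | |- computable_in ?X snd_nat => exact (computable_snd (computable_id X))
  | |- computable_in _ (fun n => fst_nat (@?f n)) =>
      apply (@computable_fst _ f); computable
  | |- computable_in _ (fun n => snd_nat (@?f n)) =>
      apply (@computable_snd _ f); computable
  | |- computable_in _ (fun n => (@?f n).+1) =>
      apply (@computable_succ _ f); computable
  | |- computable_in _ (fun n => (@?f n).-1) =>
      apply (@computable_pred _ f); computable
  | |- computable_in _ (fun n => pair_nat (@?f n) (@?g n)) =>
      apply (@computable_pair _ f g); computable
  | |- computable_in _
      (fun n => match @?b n with true => @?f n | false => @?g n end) =>
      apply (@computable_if _ b f g); computable
  | |- computable_in _ (fun n => nat_of_bool (~~ (@?b n))) =>
      apply (@computable_negb _ b); computable
  | |- computable_in _ (fun n => nat_of_bool ((@?b n) && (@?d n))) =>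
      apply (@computable_andb _ b d); computable
  | |- computable_in _ (fun n => nat_of_bool ((@?b n) || (@?d n))) =>
      apply (@computable_orb _ b d); computable
  | |- computable_in _ (fun n => nat_of_bool ((@?b n) ==> (@?d n))) =>
      apply (@computable_implyb _ b d); computable
  | |- computable_in _ (fun n => nat_of_bool (leq (@?f n) (@?g n))) =>
      apply (@computable_leq _ f g); computable
  | |- computable_in _ (fun n => nat_of_bool ((@?f n) == (@?g n))) =>
      apply (@computable_eqn _ f g); computable
  | |- _ => idtac
  end.

(** * Existential questions and the jump *)

(** Composing a program with [const_code n] hardwires the input n, as in the s-m-n theorem. *)
Fixpoint const_code (n : nat) : code :=
  if n is k.+1 then Comp Succ (const_code k) else Zero.

Lemma eval_const_code (X : nat -> bool) (k n y : nat) :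
  eval X (const_code k) n y <-> y = k.
Proof.
elim: k y => [|k IH] y //=; split=> [[z /IH-> ->]//|->].
by exists k => //; apply/IH.
Qed.

Lemma computable_const_code (X : nat -> bool) :
  computable_in X (fun n => encode (const_code n)).
Proof.
have -> : (fun n => encode (const_code n)) = (fun n => iter n
    (fun z => pair_nat 6 (pair_nat (pair_nat 1 0) z)) (pair_nat 0 0)).
  by apply: funext; elim=> //= n ->.
apply: (@computable_iter X (fun _ z => pair_nat 6 (pair_nat (pair_nat 1 0) z))
  id); computable.
Qed.

(** The search for i, with n hardwired, is a program that ignores its input. It halts on its own
    number exactly when the search succeeds, and its number is computable from n. *)
Lemma exists_turing_le_jump (X : nat -> bool) (P : nat -> nat -> bool) :
  computable_in X (fun n => P (fst_nat n) (snd_nat n)) ->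
  turing_le (fun n => `[< exists i, P n i >]) (jump X).
Proof.
move=> /computable_negb /computable_inP[c cP].
have := computable_oracle (computable_pair (computable_const (jump X) 6)
  (computable_pair (computable_const (jump X) (encode (Mu c)))
    (computable_const_code (jump X)))).
congr computable_in; apply: funext => n; congr (nat_of_bool _).
have [e eE] : exists e, e = encode (Comp (Mu c) (const_code n)) by eexists.
rewrite (_ : pair_nat 6 _ = e)//.
rewrite /jump; congr asbool; rewrite propeqE; split=> [[y [d]]|[i Pi]].
  rewrite eE => /encode_inj -> /= [z /eval_const_code -> [h0 _]].
  exists y; have := eval_inj h0 (cP (pair_nat n y)).
  by rewrite !pairE; case: (P n y).
have exP : exists i, P n i by exists i.
case: (ex_minnP exP) => j Pj jmin.
exists j, (Comp (Mu c) (const_code n)) => //=; exists n;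
  first exact/eval_const_code.
split=> [|k kj]; first by have := cP (pair_nat n j); rewrite !pairE Pj.
have := cP (pair_nat n k); rewrite !pairE.
have /negbTE-> : ~~ P n k by apply: contraL kj => /jmin; rewrite -leqNgt.
by exists 0%N.
Qed.

(** * A universal machine *)

(* A stack machine running the programs of [code].  A state is a pair of a value
   and a stack, and a stack is 0 or [push i r].  The instruction [encode c]
   replaces the value n by the output of c on n; the tags from 9 on are the
   continuations of the instructions for Pair, Prec and Mu, and tag 12 is the
   test that a number is the code of a program. *)
Definition push (i r : nat) : nat := (pair_nat i r).+1.

Arguments push : simpl never.

Lemma fst_pred_push (i r : nat) : fst_nat (push i r).-1 = i.
Proof. by rewrite /push /= fst_pair. Qed.

Lemma snd_pred_push (i r : nat) : snd_nat (push i r).-1 = r.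
Proof. by rewrite /push /= snd_pair. Qed.

Definition exec (O : nat -> bool) (v i r : nat) : nat :=
  if fst_nat i == 0%N then pair_nat 0 r
  else if fst_nat i == 1%N then pair_nat v.+1 r
  else if fst_nat i == 2%N then pair_nat (fst_nat v) r
  else if fst_nat i == 3%N then pair_nat (snd_nat v) r
  else if fst_nat i == 4%N then pair_nat (O v) r
  else if fst_nat i == 5%N then
    pair_nat v (push (fst_nat (snd_nat i))
      (push (pair_nat 10 (pair_nat (snd_nat (snd_nat i)) v)) r))
  else if fst_nat i == 6%N then
    pair_nat v (push (snd_nat (snd_nat i)) (push (fst_nat (snd_nat i)) r))
  else if fst_nat i == 7%N then
    if snd_nat v == 0%N then pair_nat (fst_nat v) (push (fst_nat (snd_nat i)) r)
    else pair_nat (pair_nat (fst_nat v) (snd_nat v).-1)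
      (push i (push (pair_nat 9 (snd_nat v).-1) (push (pair_nat 9 (fst_nat v))
        (push (snd_nat (snd_nat i)) r))))
  else if fst_nat i == 8%N then
    pair_nat (pair_nat v 0) (push (snd_nat i)
      (push (pair_nat 11 (pair_nat (snd_nat i) (pair_nat v 0))) r))
  else if fst_nat i == 9%N then pair_nat (pair_nat (snd_nat i) v) r
  else if fst_nat i == 10%N then
    pair_nat (snd_nat (snd_nat i))
      (push (fst_nat (snd_nat i)) (push (pair_nat 9 v) r))
  else if fst_nat i == 11%N then
    if v == 0%N then pair_nat (snd_nat (snd_nat (snd_nat i))) r
    else pair_nat (pair_nat (fst_nat (snd_nat (snd_nat i)))
                     (snd_nat (snd_nat (snd_nat i))).+1)
      (push (fst_nat (snd_nat i)) (push (pair_nat 11 (pair_nat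
        (fst_nat (snd_nat i)) (pair_nat (fst_nat (snd_nat (snd_nat i)))
                     (snd_nat (snd_nat (snd_nat i))).+1))) r))
  else if (fst_nat (snd_nat i) <= 4)%N && (snd_nat (snd_nat i) == 0%N) then
    pair_nat v r
  else if (5 <= fst_nat (snd_nat i))%N && (fst_nat (snd_nat i) <= 7)%N then
    pair_nat v (push (pair_nat 12 (fst_nat (snd_nat (snd_nat i))))
      (push (pair_nat 12 (snd_nat (snd_nat (snd_nat i)))) r))
  else if fst_nat (snd_nat i) == 8%N then
    pair_nat v (push (pair_nat 12 (snd_nat (snd_nat i))) r)
  else pair_nat v (push i r).

Definition step (O : nat -> bool) (st : nat) : nat :=
  if snd_nat st == 0%N then st
  else exec O (fst_nat st) (fst_nat (snd_nat st).-1) (snd_nat (snd_nat st).-1).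

Definition halted (st : nat) : bool := snd_nat st == 0%N.

(** The check comes first because [exec] would also run some numbers that code no program. A failed
    check loops forever, as [Phi] is nowhere defined there. *)
Definition init (e : nat) : nat :=
  pair_nat e (push (pair_nat 12 e) (push e 0)).

Section Machine.
Variable O : nat -> bool.

Lemma step_push (v i r : nat) : step O (pair_nat v (push i r)) = exec O v i r.
Proof.
have push0 : (push i r == 0%N) = false by [].
by rewrite /step (snd_pair v) push0 (fst_pair v) fst_pred_push snd_pred_push.
Qed.

Lemma step_halted (st : nat) : halted st -> step O st = st.
Proof. by rewrite /step /halted => ->. Qed.

Lemma iter_halted (p q st : nat) : (p <= q)%N ->
  halted (iter p (step O) st) -> iter q (step O) st = iter p (step O) st.
Proof.
move=> /subnK <- h; rewrite iterD; move: h.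
elim: (q - p)%N => //= k IH h; rewrite IH//; exact: step_halted.
Qed.

Lemma halted_leq (p q st : nat) : (p <= q)%N ->
  halted (iter p (step O) st) -> halted (iter q (step O) st).
Proof. by move=> pq h; rewrite (iter_halted pq h). Qed.

Definition reach (st st' : nat) : Prop :=
  exists p, iter p (step O) st = st'.

Lemma reach_trans (s t u : nat) : reach s t -> reach t u -> reach s u.
Proof. by move=> [p <-] [q <-]; exists (q + p)%N; rewrite iterD. Qed.

Lemma reach_step (v i r t : nat) :
  reach (exec O v i r) t -> reach (pair_nat v (push i r)) t.
Proof. by move=> [p <-]; exists p.+1; rewrite iterSr step_push. Qed.

Lemma reach_refl (s : nat) : reach s s. Proof. by exists 0%N. Qed.

Lemma reach_eval (c : code) (n y r : nat) : eval O c n y ->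
  reach (pair_nat n (push (encode c) r)) (pair_nat y r).
Proof.
elim: c n y r => [|||||a IHa b IHb|a IHa b IHb|a IHa b IHb|a IHa] n y r /= ev;
  try by rewrite ev; apply: reach_step; rewrite /exec !pairE /=;
    exact: reach_refl.
- case: ev => u [v [/IHa au /IHb bv ->]].
  apply: reach_step; rewrite /exec !pairE /=; apply: reach_trans (au _) _.
  (* Tag 10 has kept the second program and the original input; it restores that input and leaves u
     to a tag 9 instruction, which pairs it with v. *)
  apply: reach_step; rewrite /exec !pairE /=; apply: reach_trans (bv _) _.
  by apply: reach_step; rewrite /exec !pairE /=; exact: reach_refl.
- case: ev => u /IHb bu /IHa au.
  apply: reach_step; rewrite /exec !pairE /=; apply: reach_trans (bu _) _.
  exact: au.
- move: ev; rewrite -[in reach (pair_nat n _)](pair_fst_snd n).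
  rewrite -/(fst_nat n) -/(snd_nat n).
  elim: (snd_nat n) y r => [|k IH] y r /=.
    move=> /IHa ay; apply: reach_step; rewrite /exec !pairE /=; exact: ay.
  move=> [z /IH kz /IHb bz].
  apply: reach_step; rewrite /exec !pairE /=; apply: reach_trans (kz _) _.
  (* The two tag 9 instructions prepend first k and then the parameter to z, which builds the input
     of the step program. *)
  apply: reach_step; rewrite /exec !pairE /=.
  apply: reach_step; rewrite /exec !pairE /=.
  exact: bz.
- case: ev => /IHa a0 ai.
  apply: reach_step; rewrite /exec !pairE /=.
  (* Tag 11 remembers the program and the argument under test; k counts the tests still to fail. *)
  suff H k i : (i + k)%N = y -> reach (pair_nat (pair_nat n i) (push (encode a)
      (push (pair_nat 11 (pair_nat (encode a) (pair_nat n i))) r)))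
      (pair_nat y r) by exact: (H y 0%N).
  elim: k i => [|k IH] i.
    rewrite addn0 => ->; apply: reach_trans (a0 _) _.
    by apply: reach_step; rewrite /exec !pairE /=; exact: reach_refl.
  move=> iky; have [|v /IHa av] := ai i; first by lia.
  apply: reach_trans (av _) _; apply: reach_step; rewrite /exec !pairE /=.
  by apply: IH; rewrite addSnnS.
Qed.

Lemma reach_check (c : code) (n r : nat) :
  reach (pair_nat n (push (pair_nat 12 (encode c)) r)) (pair_nat n r).
Proof.
elim: c r => [|||||a IHa b IHb|a IHa b IHb|a IHa b IHb|a IHa] r /=;
  apply: reach_step; rewrite /exec !pairE /=; try exact: reach_refl.
- exact: reach_trans (IHa _) (IHb _).
- exact: reach_trans (IHa _) (IHb _).
- exact: reach_trans (IHa _) (IHb _).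
- exact: IHa.
Qed.

Lemma halts_push (p v i r : nat) :
  halted (iter p (step O) (pair_nat v (push i r))) ->
  exists2 q, (q < p)%N & halted (iter q (step O) (exec O v i r)).
Proof.
case: p => [|p]; first by rewrite /= /halted pairE.
by rewrite iterSr step_push; exists p.
Qed.

(** Halting means an empty stack, so a halting run must finish the instruction on top and then go on
    with r. The strict decrease of the remaining time is what the loop of [Mu] needs. *)
Lemma halts_eval (c : code) (p n r : nat) :
  halted (iter p (step O) (pair_nat n (push (encode c) r))) ->
  exists y q, [/\ eval O c n y, (q < p)%N
    & halted (iter q (step O) (pair_nat y r))].
Proof.
elim: c p n r => [|||||a IHa b IHb|a IHa b IHb|a IHa b IHb|a IHa] p n r /=
  /halts_push[q qp]; rewrite /exec !pairE /=.
- by exists 0%N, q.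
- by exists n.+1, q.
- by exists (fst_nat n), q.
- by exists (snd_nat n), q.
- by exists (O n : nat), q.
- move=> /IHa[u [q1 [au q1q]]] /halts_push[q2 q21]; rewrite /exec !pairE /=.
  move=> /IHb[v [q3 [bv q32]]] /halts_push[q4 q43].
  rewrite /exec !pairE /= => h.
  exists (pair_nat u v), q4; split => //; last by lia.
  by exists u, v.
- move=> /IHb[u [q1 [bu q1q]]] /IHa[v [q2 [av q21]]] h.
  by exists v, q2; split => //; [exists u|lia].
- rewrite -/(fst_nat n) -/(snd_nat n).
  suff H k x p' r' :
      halted (iter p' (step O) (pair_nat (pair_nat x k)
        (push (pair_nat 7 (pair_nat (encode a) (encode b))) r'))) ->
      exists y q', [/\ prec_graph (eval O a) (eval O b) x k y, (q' < p')%N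
        & halted (iter q' (step O) (pair_nat y r'))].
    case: ifP => [/eqP ->|/negbT n0] h.
      have [y [q' [ay q'q h']]] := IHa _ _ _ h.
      by exists y, q'; split => //; lia.
    have [|y [q' [yP q'q h']]] := H (snd_nat n) (fst_nat n) q.+1 r; last first.
      by exists y, q'; split => //; lia.
    rewrite iterSr step_push /exec !pairE /=.
    by rewrite (negbTE n0).
  elim: k p' r' => [|k IHk] p' r' /= /halts_push[q1 q1p];
    rewrite /exec !pairE /=.
    move=> /IHa[y [q2 [ay q21 h]]].
    by exists y, q2; split => //; lia.
  move=> /IHk[z [q2 [kz q21]]] /halts_push[q3 q32]; rewrite /exec !pairE /=.
  move=> /halts_push[q4 q43]; rewrite /exec !pairE /=.
  move=> /IHb[y [q5 [bz q54 h]]].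
  by exists y, q5; split => //; [exists z|lia].
(* The number of tests is not bounded in advance, so the induction is on the running time. *)
- suff H m : forall i, (forall j, (j < i)%N ->
        exists v, eval O a (pair_nat n j) v.+1) ->
      halted (iter m (step O) (pair_nat (pair_nat n i) (push (encode a)
        (push (pair_nat 11 (pair_nat (encode a) (pair_nat n i))) r)))) ->
      exists y q', [/\ eval O a (pair_nat n y) 0 /\ (forall i, (i < y)%N ->
          exists v, eval O a (pair_nat n i) v.+1), (q' < m)%N
        & halted (iter q' (step O) (pair_nat y r))].
    move=> h; have [//|y [q' [yP q'q h']]] := H _ 0%N _ h.
    by exists y, q'; split => //; lia.
  elim/ltn_ind: m => m IHm i iP /IHa[v [q1 [av q1m]]] /halts_push[q2 q21].
  rewrite /exec !pairE /=; case: v av => [|v] av /= h.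
    by exists i, q2; split => //; lia.
  have [||y [q' [yP q'q h']]] := IHm q2 _ i.+1 _ h; first by lia.
    move=> j; rewrite ltnS leq_eqVlt => /predU1P[->|/iP//].
    by exists v.
  by exists y, q'; split => //; lia.
Qed.

Lemma halts_check (p n e r : nat) :
  halted (iter p (step O) (pair_nat n (push (pair_nat 12 e) r))) ->
  exists c q, [/\ encode c = e, (q < p)%N
    & halted (iter q (step O) (pair_nat n r))].
Proof.
elim/ltn_ind: p e r => p IH e r; rewrite -(pair_fst_snd e).
move: (fst_nat e) (snd_nat e) => t d /halts_push[q qp]; rewrite /exec !pairE /=.
case: ifP => [/andP[t4 /eqP ->] h|_].
  case: t t4 => [|[|[|[|[|//]]]]] _.
  - by exists Zero, q.
  - by exists Succ, q.
  - by exists Fst, q.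
  - by exists Snd, q.
  - by exists Oracle, q.
rewrite -(pair_fst_snd d); move: (fst_nat d) (snd_nat d) => d1 d2.
rewrite !pairE.
case: ifP => [/andP[t5 t7]|_].
  move=> /IH[//|a [q1 [<- q1q]]] /IH[|b [q2 [<- q21 h]]]; first by lia.
  have q2p : (q2 < p)%N by lia.
  case: t t5 t7 => [|[|[|[|[|[|[|[|//]]]]]]]] //= _ _.
  - by exists (Pair a b), q2.
  - by exists (Comp a b), q2.
  - by exists (Prec a b), q2.
case: eqP => [->|_].
  move=> /IH[//|a [q1 [ae q1q h]]].
  by exists (Mu a), q1; split => //=; [rewrite ae|lia].
(* No tag matches: the check has reproduced its own state with less time left, and the induction
   hypothesis applies. *)
case: q qp => [|q] qp; first by rewrite /= /halted pairE.
move=> /IH[|c [q1 [ce q1q h]]]; first by lia.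
by exists c, q1; split => //; lia.
Qed.

Lemma jumpP (e : nat) :
  (jump O e : Prop) <-> exists p, halted (iter p (step O) (init e)).
Proof.
split=> [/asboolP[y [c ce cy]]|[p]]; last first.
  rewrite /init => /halts_check[c [q [ce _]]].
  rewrite -ce => /halts_eval[y [_ [cy _ _]]].
  by apply/asboolP; exists y, c.
have [p pP] : reach (init e) (pair_nat y 0).
  rewrite /init -ce; apply: reach_trans (reach_check _ _ _) _.
  by apply: reach_eval; rewrite ce.
by exists p; rewrite pP /halted pairE.
Qed.

End Machine.

Lemma computable_push (X : nat -> bool) (f g : nat -> nat) :
  computable_in X f -> computable_in X g ->
  computable_in X (fun n => push (f n) (g n)).
Proof. by move=> fP gP; apply: computable_succ; apply: computable_pair. Qed.

Ltac computable_push := computable; lazymatch goal with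
  | |- computable_in _ (fun n => push (@?f n) (@?g n)) =>
      apply (@computable_push _ f g); computable_push
  | |- _ => idtac
  end.

(** The oracle is a uniformly computable family, so that one statement serves both a fixed set and
    the stages of 0'. *)
Lemma computable_step (X : nat -> bool) (O : nat -> nat -> bool) :
  computable_in X (fun n => O (fst_nat n) (snd_nat n)) ->
  computable_in X (fun n => step (O (fst_nat n)) (snd_nat n)).
Proof.
move=> OP.
have OP' : computable_in X (fun n => O (fst_nat n) (fst_nat (snd_nat n))).
  by apply: (@computable_comp2 X (fun u v => O u v : nat)) OP _ _; computable.
rewrite /step /exec; computable_push.
Qed.

Lemma computable_halted_iter (X : nat -> bool) (O : nat -> nat -> bool)
    (s p e : nat -> nat) :
  computable_in X (fun n => O (fst_nat n) (snd_nat n)) ->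
  computable_in X s -> computable_in X p -> computable_in X e ->
  computable_in X (fun n => halted (iter (p n) (step (O (s n))) (init (e n)))).
Proof.
move=> OP sP pP eP; apply: computable_eqn; last exact: computable_const.
apply: computable_snd.
apply: (@computable_iter X (fun u v => step (O u) v)) => //.
  exact: computable_step.
by rewrite /init; computable_push.
Qed.

(** Running the machine with oracle A for p steps is computable in B, so halting relative to A is an
    existential question over B. *)
Lemma jump_turing_le (A B : nat -> bool) :
  turing_le A B -> turing_le (jump A) (jump B).
Proof.
move=> AB.
have hP : computable_in B
    (fun n => halted (iter (snd_nat n) (step A) (init (fst_nat n)))).
  apply: (@computable_halted_iter B (fun _ q => A q) (fun=> 0%N)); computable.
  by apply: (@computable_comp B (fun n => A n : nat)) AB _; computable.
have := @exists_turing_le_jump B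
  (fun e p => halted (iter p (step A) (init e))) hP.
congr turing_le; apply: funext => e.
apply/idP/idP => [/asboolP/jumpP//|/jumpP eA].
exact/asboolP.
Qed.

(** * Approximating 0' in stages *)

Definition halting_stage (s q : nat) : bool :=
  halted (iter s (step emptyset) (init q)).

Lemma halting_stageP (q : nat) : exists s0, forall s, (s0 <= s)%N ->
  halting_stage s q = jump emptyset q.
Proof.
have [/jumpP[p h]|nj] := boolP (jump emptyset q).
  by exists p => s ps; apply: halted_leq ps h.
exists 0%N => s _; apply: contraNF nj => h; apply/jumpP; by exists s.
Qed.

(** The use principle: each step queries the oracle at most once, at the current value, and every
    single answer is correct from some stage on. *)
Lemma iter_halting_stage (p st : nat) : exists s0, forall s, (s0 <= s)%N ->
  iter p (step (halting_stage s)) st = iter p (step (jump emptyset)) st.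
Proof.
elim: p => [|p [s0 IH]]; first by exists 0%N.
set t := iter p (step (jump emptyset)) st in IH.
have [s1 s1P] := halting_stageP (fst_nat t).
exists (maxn s0 s1) => s; rewrite geq_max => /andP[/IH /= -> /s1P].
by rewrite -/t /step /exec => ->.
Qed.

(* The fuel stays bounded, that is, stage_fails e s holds for finitely many s
   only, if and only if the run of e halts with the true oracle 0'. *)
Fixpoint fuel (e s : nat) : nat :=
  if s is s'.+1 then
    if halted (iter (fuel e s') (step (halting_stage s')) (init e))
    then fuel e s' else (fuel e s').+1
  else 0.

Definition stage_fails (e s : nat) : bool :=
  ~~ halted (iter (fuel e s) (step (halting_stage s)) (init e)).

Lemma fuelS (e s : nat) : fuel e s.+1 = (fuel e s + stage_fails e s)%N.
Proof. by rewrite /= /stage_fails; case: halted; rewrite ?addn0 ?addn1. Qed.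

Lemma fuel_leq (e s t : nat) : (s <= t)%N -> (fuel e s <= fuel e t)%N.
Proof.
move=> /subnK <-; elim: (t - s)%N => // k IH.
by rewrite addSn fuelS (leq_trans IH)// leq_addr.
Qed.

(** If the fuel settles, late stages agree with 0' for that many steps, so the true run halts. If
    the true run halts in p steps, infinitely many failures would raise the fuel to p, after which
    every late stage succeeds. *)
Lemma jump_jumpP (e : nat) : (jump (jump emptyset) e : Prop) <->
  exists w, forall t, (w <= t)%N -> ~~ stage_fails e t.
Proof.
split=> [/jumpP[p h]|[w wP]]; last first.
  have fw t : (w <= t)%N -> fuel e t = fuel e w.
    move=> /subnK <-; elim: (t - w)%N => // k IH.
    by rewrite addSn fuelS IH (negbTE (wP _ _)) ?addn0// leq_addl.
  have [s0 s0P] := iter_halting_stage (fuel e w) (init e).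
  apply/jumpP; exists (fuel e w).
  have /wP : (w <= maxn w s0)%N by rewrite leq_maxl.
  by rewrite /stage_fails fw ?leq_maxl// s0P ?leq_maxr// negbK.
have [s0 s0P] := iter_halting_stage p (init e).
apply: contrapT => /forallNP ninf.
have [s sP] : exists s, (p <= fuel e s)%N.
  elim: p {h s0 s0P} => [|k [s ks]]; first by exists 0%N.
  have := ninf s; rewrite -existsNE => -[t] /not_implyP[st] /negP.
  rewrite negbK => tf; exists t.+1.
  by rewrite fuelS tf addn1 ltnS (leq_trans ks)// fuel_leq.
apply: (ninf (maxn s s0)) => t; rewrite geq_max => /andP[st s0t].
rewrite /stage_fails negbK; apply: (@halted_leq _ p).
  by rewrite (leq_trans sP)// fuel_leq.
by rewrite s0P.
Qed.

Lemma computable_stage_fails (X : nat -> bool) (e s : nat -> nat) :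
  computable_in X e -> computable_in X s ->
  computable_in X (fun n => stage_fails (e n) (s n)).
Proof.
move=> eP sP.
have hP : computable_in X (fun n => halting_stage (fst_nat n) (snd_nat n)).
  apply: (@computable_halted_iter X (fun=> emptyset) (fun=> 0%N)); computable.
  exact: (computable_const X 0).
have fP : computable_in X (fun n => fuel (fst_nat n) (snd_nat n)).
  have := @computable_rect X (fun=> 0%N)
    (fun e s z => if halted (iter z (step (halting_stage s)) (init e))
      then z else z.+1) fst_nat snd_nat.
  have -> : (fun n => fuel (fst_nat n) (snd_nat n)) = (fun n =>
      nat_rect (fun=> nat) 0%N (fun s z =>
        if halted (iter z (step (halting_stage s)) (init (fst_nat n)))
        then z else z.+1) (snd_nat n)).
    by apply: funext => n; elim: (snd_nat n) => //= k ->.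
  apply; computable.
  by apply: (computable_halted_iter hP); computable.
apply: computable_negb; apply: (computable_halted_iter hP) => //.
exact: computable_comp2 fP _ _.
Qed.

(** * Independent bits *)

Import Order.TTheory GRing.Theory Num.Theory.
Import numFieldNormedType.Exports.

Local Open Scope classical_set_scope.
Local Open Scope ring_scope.

Lemma measurable_cylinder (s : seq bool) : measurable (cylinder s : set cantor).
Proof. by apply: sub_sigma_algebra; exists s. Qed.

(** Invariance of a set under flipping bit i serves below as its independence from that bit. *)
Definition flip_bit (i : nat) (X : cantor) : cantor :=
  fun n => X n (+) (n == i).

Lemma flip_bit_cylinder (i : nat) (s : seq bool) : flip_bit i @^-1` cylinder s =
  cylinder (mkseq (fun n => nth false s n (+) (n == i)) (size s)).
Proof.
apply/seteqP; split=> X; rewrite /cylinder /= size_mkseq => Xs.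
  apply: (@eq_from_nth _ false); rewrite !size_mkseq// => n ns.
  by rewrite !nth_mkseq// -Xs nth_mkseq// /flip_bit -addbA addbb addbF.
apply: (@eq_from_nth _ false); rewrite !size_mkseq// => n ns.
have := congr1 (fun u => nth false u n) Xs.
rewrite !nth_mkseq// /flip_bit => ->.
by rewrite -addbA addbb addbF.
Qed.

Lemma measurable_flip_bit (i : nat) : measurable_fun setT (flip_bit i).
Proof.
apply: (@measurability _ _ cantor cantor setT (flip_bit i)
  (range cylinder) erefl) => _ [_ [s _ <-] <-].
by rewrite setTI flip_bit_cylinder; exact: measurable_cylinder.
Qed.

HB.instance Definition _ (i : nat) :=
  isMeasurableFun.Build _ _ cantor cantor (flip_bit i) (measurable_flip_bit i).

Lemma cylinderI (s t : seq bool) :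
  cylinder s `&` cylinder t = set0 \/
  exists u, cylinder s `&` cylinder t = cylinder u.
Proof.
wlog st : s t / (size s <= size t)%N.
  move=> H; have [/H//|/ltnW/H] := leqP (size s) (size t).
  by rewrite setIC.
have [e|ne] := eqVneq s (take (size s) t).
  right; exists t; apply/seteqP; split=> X; first by case.
  move=> Xt; split=> //; move: Xt; rewrite /cylinder /= => Xt.
  rewrite [RHS]e -[t in RHS]Xt /mkseq -map_take take_iota.
  by congr map; congr iota; lia.
left; apply/seteqP; split=> X //=; rewrite /cylinder /= => -[Xs Xt].
move: ne; rewrite -[X in X != _]Xs -[t in take _ t]Xt /mkseq -map_take take_iota.
by rewrite (minn_idPl st) eqxx.
Qed.

Definition all_ones (s : seq nat) : set cantor := [set X | all X s].

Definition bit_set (i : nat) : set cantor := [set X | X i].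

Section Measure.
Context (R : realType).
Local Notation mu := (fair_coin R).

(** Flipping a bit maps cylinders to cylinders of the same length. With the empty set added,
    cylinders form a generating class closed under intersection, so the two measures agree. *)
Lemma fair_coin_flip_bit (i : nat) (A : set cantor) : measurable A ->
  mu (flip_bit i @^-1` A) = mu A.
Proof.
move=> mA.
pose G : set (set cantor) := [set B | B = set0 \/ exists s, B = cylinder s].
have := @measure_unique _ R cantor G (fun=> cylinder [::]) _ _ _ _
  (distribution mu (flip_bit i)) mu _ _ A mA; apply.
- apply/seteqP; split.
    apply: smallest_sub; first exact: smallest_sigma_algebra.
    by move=> _ [s _ <-]; apply: sub_sigma_algebra; right; exists s.
  apply: smallest_sub; first exact: smallest_sigma_algebra.
  move=> B [->|[s ->]]; first exact: measurable0.
  exact: measurable_cylinder.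
- move=> B D [->|[s ->]]; first by rewrite set0I; left.
  move=> [->|[t ->]]; first by rewrite setI0; left.
  by have [->|[u ->]] := cylinderI s t; [left|right; exists u].
- by move=> _; right; exists [::].
- by apply/seteqP; split=> // X _; exists 0%N.
- move=> B [->|[s ->]]; first by rewrite !measure0.
  rewrite -[LHS]/(mu (flip_bit i @^-1` cylinder s)) flip_bit_cylinder.
  by rewrite fair_coin_cylinder size_mkseq -fair_coin_cylinder.
- move=> k; apply: le_lt_trans (ltry 1%R); apply: probability_le1.
  exact: measurable_cylinder.
Qed.

Lemma measurable_bit (i : nat) : measurable (bit_set i).
Proof.
(* A countable union, over strings enumerated by [unpickle], of the cylinders of length i + 1 whose
   last bit is 1. *)
have -> : bit_set i = \bigcup_k
    (if @unpickle (seq bool) k is Some s then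
       if (size s == i.+1) && last false s then cylinder s else set0
     else set0).
  apply/seteqP; split=> [X Xi|X [k _]]; last first.
    case: unpickle => // s; case: ifP => // /andP[/eqP si sl].
    rewrite /cylinder /= si mkseqS => Xs.
    by move: sl; rewrite -Xs last_rcons.
  exists (pickle (mkseq X i.+1)) => //.
  have e : last false (mkseq X i.+1) by rewrite mkseqS last_rcons.
  by rewrite pickleK size_mkseq eqxx e /cylinder /mkset size_mkseq.
apply: bigcupT_measurable => k.
by case: ifP => _; [exact: measurable_cylinder|exact: measurable0].
Qed.

Lemma all_ones_cons (i : nat) (s : seq nat) :
  all_ones (i :: s) = all_ones s `&` bit_set i.
Proof.
apply/seteqP; split=> X; rewrite /all_ones /bit_set /=; first by case/andP.
by case=> -> ->.
Qed.

Lemma measurable_all_ones (s : seq nat) : measurable (all_ones s).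
Proof.
elim: s => [|i s IH].
  by rewrite (_ : all_ones _ = setT) //; apply/seteqP; split.
by rewrite all_ones_cons; apply: measurableI => //; exact: measurable_bit.
Qed.

Lemma flip_bit_all_ones (i : nat) (s : seq nat) : i \notin s ->
  flip_bit i @^-1` all_ones s = all_ones s.
Proof.
move=> si; apply/seteqP; split=> X; rewrite /all_ones /= => /allP Xs;
  apply/allP => j js; have := Xs j js; rewrite /flip_bit;
  by case: eqP => [ji|_]; [rewrite -ji js in si|rewrite addbF].
Qed.

Lemma fair_coin_fin (A : set cantor) : measurable A -> mu A = (fine (mu A))%:E.
Proof. by move=> mA; rewrite fineK// fin_num_measure. Qed.

(** The flip exchanges the two halves of C and preserves measure. *)
Lemma fair_coin_half (i : nat) (C : set cantor) : measurable C ->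
  flip_bit i @^-1` C = C -> mu (C `&` bit_set i) = ((fine (mu C)) / 2)%:E.
Proof.
move=> mC Ci.
have mi := measurable_bit i.
have mD : measurable (C `\` bit_set i) by exact: measurableD.
have mI : measurable (C `&` bit_set i) by exact: measurableI.
have e1 : mu (C `\` bit_set i) = mu (C `&` bit_set i).
  rewrite -(@fair_coin_flip_bit i (C `&` _))// preimage_setI Ci; congr (mu _).
  apply/seteqP; split=> X /= [CX]; rewrite /bit_set /= /flip_bit eqxx addbT.
    by move=> /negP.
  by move=> /negP.
have : mu C = (mu (C `&` bit_set i) + mu (C `\` bit_set i))%E.
  rewrite -measureU// ?setUIDK//.
    by apply/seteqP; split=> X //= [[_ Xi] [_]].
rewrite e1 (fair_coin_fin mI); move: (fine _) => x ->.
by rewrite /=; congr (_%:E); lra.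
Qed.

(** Each bit of [s] halves the measure by [fair_coin_half]: flipping it affects neither C nor, as
    [s] has no repetitions, the conditions on the other bits. *)
Lemma fair_coin_all_ones (s : seq nat) (C : set cantor) : measurable C ->
  uniq s -> {in s, forall i, flip_bit i @^-1` C = C} ->
  mu (C `&` all_ones s) = (fine (mu C) * 2^-1 ^+ size s)%:E.
Proof.
move=> mC; elim: s => [_ _|i s IH]; last rewrite cons_uniq => /andP[si us] sC.
  rewrite (_ : all_ones _ = setT); last by apply/seteqP; split.
  by rewrite setIT mulr1 -fair_coin_fin.
rewrite all_ones_cons setIA fair_coin_half.
- rewrite IH//; last by move=> j js; apply: sC; rewrite inE js orbT.
  by congr (_%:E); rewrite /= exprSr mulrA.
- by apply: measurableI => //; exact: measurable_all_ones.
- by rewrite preimage_setI flip_bit_all_ones// sC// mem_head.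
Qed.

Lemma fair_coin_all_ones_bigcup (s : nat -> seq nat) :
  (forall n, uniq (s n)) -> (forall n, size (s n) = n.+2) ->
  (mu (\bigcup_n all_ones (s n)) <= (2^-1)%:E)%E.
Proof.
move=> us ss.
have ms n : measurable (all_ones (s n)) by exact: measurable_all_ones.
apply: (@le_trans _ _ (\sum_(0 <= n <oo) mu (all_ones (s n)))%E).
  apply: measure_sigma_subadditive => //; exact: bigcupT_measurable.
(* The terms 2^-(n+2) are 1/2 times 2^-(n+1), and so sum to 1/2. *)
apply: le_trans (@epsilon_trick0 R 2^-1 xpredT _); last by lra.
apply: lee_nneseries => // n _.
rewrite -(setTI (all_ones _)) fair_coin_all_ones// probability_setT ss.
rewrite mul1r lee_fin exprS natrX exprVn; exact: lexx.
Qed.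

(** Avoiding ones on the first m blocks constrains only bits outside block m, by disjointness. Each
    block thus multiplies the measure by 1 - 2^-k, and the powers tend to 0. *)
Lemma negligible_avoid_all_ones (k : nat) (s : nat -> seq nat) :
  (forall n, uniq (s n)) -> (forall n, size (s n) = k) ->
  (forall m n i, i \in s m -> i \in s n -> m = n) ->
  mu.-negligible [set X : cantor | forall n, ~~ all X (s n)].
Proof.
move=> us ss ds.
pose C m : set cantor := [set X | forall n, (n < m)%N -> ~~ all X (s n)].
have C0 : C 0%N = setT by apply/seteqP; split.
have CS m : C m.+1 = C m `\` all_ones (s m).
  apply/seteqP; split=> X /=.
    by move=> CX; split; [move=> n nm; apply: CX; exact: ltnW|apply/negP/CX].
  by move=> [CX /negP Xm] n; rewrite ltnS leq_eqVlt => /predU1P[->//|/CX].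
have mC m : measurable (C m).
  elim: m => [|m IH]; first by rewrite C0.
  by rewrite CS; apply: measurableD => //; exact: measurable_all_ones.
have Cflip m n i : (m <= n)%N -> i \in s n -> flip_bit i @^-1` C m = C m.
  elim: m => [|m IH] mn isn; first by rewrite C0.
  rewrite CS setDE preimage_setI -preimage_setC IH//; last exact: ltnW.
  rewrite flip_bit_all_ones//; apply: contraTN mn => ism.
  by rewrite (ds _ _ _ ism isn) ltnn.
pose q : R := 1 - 2^-1 ^+ k.
have CE m : mu (C m) = (q ^+ m)%:E.
  elim: m => [|m IH]; first by rewrite C0 probability_setT.
  have h := fair_coin_all_ones (mC m) (us m) (fun i => @Cflip m m i (leqnn m)).
  have Cfin : (mu (C m) < +oo)%E by rewrite IH ltry.
  transitivity (mu (C m) - mu (C m `&` all_ones (s m)))%E.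
    by rewrite CS; apply: measureD => //; exact: measurable_all_ones.
  rewrite h IH ss -EFinB -[fine _]/(q ^+ m); congr (_%:E).
  by rewrite exprSr mulrBr mulr1.
exists (\bigcap_m C m); split.
- exact: bigcapT_measurable.
- apply/eqP; rewrite eq_le measure_ge0 andbT.
  rewrite fair_coin_fin ?lee_fin; last exact: bigcapT_measurable.
  have qq : `|q| < 1.
    have h0 : 0 < 2^-1 ^+ k :> R by rewrite exprn_gt0// invr_gt0.
    have h1 : 2^-1 ^+ k <= 1 :> R by apply: exprn_ile1; lra.
    by rewrite /q ltr_norml; apply/andP; split; lra.
  have := @cvg_geometric R 1 q qq; rewrite /geometric /= => cq.
  apply: (cvgr_to_ge cq); near=> m.
  rewrite mul1r -lee_fin -CE -fair_coin_fin; last exact: bigcapT_measurable.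
  apply: le_measure; rewrite ?inE//; first exact: bigcapT_measurable.
  exact: bigcap_inf.
- by move=> X XC m _ n _; exact: XC.
Unshelve. all: by end_near.
Qed.

End Measure.

(** * The theorem *)

(* With e + 2 bits in the block of <e, t>, the events "block <e, t_e> consists of
   ones" have total probability at most 1/2, for every choice of the t_e. *)
Definition block (n : nat) : seq nat :=
  [seq pair_nat n i | i <- iota 0 (fst_nat n).+2].

Lemma uniq_block (n : nat) : uniq (block n).
Proof.
by rewrite map_inj_uniq ?iota_uniq// => i j /pair_nat_inj[].
Qed.

Lemma size_block (n : nat) : size (block n) = (fst_nat n).+2.
Proof. by rewrite size_map size_iota. Qed.

Lemma mem_block (m n i : nat) : i \in block m -> i \in block n -> m = n.
Proof. by move=> /mapP[j _ ->] /mapP[k _ /pair_nat_inj[]]. Qed.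

Lemma leq_pair_nat (x y : nat) : (y <= pair_nat x y)%N.
Proof.
have := Cantor.to_nat_non_decreasing x y.
by rewrite -/(pair_nat x y); lia.
Qed.

Lemma computable_all_block (X : nat -> bool) :
  computable_in X (fun n => all X (block n)).
Proof.
have : computable_in X
    (fun n => all (fun i => X (pair_nat n i)) (iota 0 (fst_nat n).+2)).
  apply: (@computable_all_iota X (fun n i => X (pair_nat n i)) id); computable.
  by apply: computable_oracle; computable.
by congr computable_in; apply: funext => n; rewrite /block all_map.
Qed.

Section Domination.
Variables (R : realType) (A : nat -> bool) (Q : nat -> nat -> bool).
Hypothesis computable_Q :
  forall X, computable_in X (fun n => Q (fst_nat n) (snd_nat n)).
Hypothesis ae_domA : ae_dominating R A.
Local Notation mu := (fair_coin R).

(* The function g of the outline is the least i such that waits X n i. *)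
Definition waits (X : nat -> bool) (n i : nat) : bool :=
  (Q (fst_nat n) (snd_nat n) && all X (block n)) ==>
  ((snd_nat n < i)%N && Q (fst_nat n) i).

Lemma computable_waits (X : nat -> bool) :
  computable_in X (fun n => waits X (fst_nat n) (snd_nat n)).
Proof.
have Qc (f g : nat -> nat) : computable_in X f -> computable_in X g ->
    computable_in X (fun n => Q (f n) (g n)).
  by move=> fP gP; apply: (@computable_comp2 X (fun u v => Q u v : nat)).
have bc : computable_in X (fun n => all X (block (fst_nat n))).
  by apply: (@computable_comp X (fun n => all X (block n) : nat));
    [exact: computable_all_block|computable].
rewrite /waits; computable; apply: Qc; computable.
Qed.

Definition infinitely_often (e : nat) : Prop :=
  forall w, exists2 t, (w < t)%N & Q e t.

(** The search at <e, s> can fail only if s is the last element of [Q e]. Let [t e] be that element,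
    or 0 if every element has a successor; the excluded set asks for ones on its block. *)
Lemma waits_total : exists t : nat -> nat, forall X,
  ~ (\bigcup_e all_ones (block (pair_nat e (t e)))) X ->
  forall n, exists i, waits X n i.
Proof.
have last e : exists t, forall s, Q e s -> s <> t ->
    exists2 i, (s < i)%N & Q e i.
  have [next|] := pselect (forall s, Q e s -> exists2 i, (s < i)%N & Q e i).
    by exists 0%N => s /next.
  move=> /existsNP[t /not_implyP[Qt nt]]; exists t => s Qs st.
  have [ts|ts|//] := ltngtP s t; first by exists t.
  by case: nt; exists s.
have [t tP] := choice last; exists t => X nX n.
have [/andP[Qn Xn]|nw] := boolP (Q (fst_nat n) (snd_nat n) && all X (block n));
  last by exists 0%N; rewrite /waits (negbTE nw).
have nt : snd_nat n <> t (fst_nat n).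
  move=> nt; apply: nX; exists (fst_nat n) => //.
  by rewrite -nt pair_fst_snd.
have [i ni Qi] := tP _ _ Qn nt.
by exists i; rewrite /waits ni Qi implybT.
Qed.

(** If every f fails, the sets [B k m] below are null. Together with the exceptional set of
    domination they cover the X outside [U], for which g is total; but [U] has measure at most
    1/2. *)
Lemma exists_bound : exists2 f, computable_in A f &
  forall e, infinitely_often e -> exists w, forall t, (w < t)%N -> Q e t ->
    exists i, [/\ (t < i)%N, (i < f (pair_nat e t))%N & Q e i].
Proof.
apply: contrapT => nf.
have {nf} nf (f : nat -> nat) : computable_in A f ->
  exists2 e, infinitely_often e &
    forall w, exists t, [/\ (w < t)%N, Q e t &
      forall i, (t < i)%N -> (i < f (pair_nat e t))%N -> ~ Q e i].
  move=> fA; apply: contrapT => ne; apply: nf; exists f => // e eio.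
  apply: contrapT => nw; apply: ne; exists e => // w.
  apply: contrapT => nt; apply: nw; exists w => t wt Qt.
  apply: contrapT => ni; apply: nt; exists t; split=> // i ti fi Qi.
  by apply: ni; exists i.
(* The X whose g is bounded beyond m by the function with number k relative to A; only countably
   many such sets arise. *)
pose B (k m : nat) : set cantor := [set X | exists f,
  (forall n, Phi A k n (f n)) /\
  forall n, (m < n)%N -> exists2 i, (i < f n)%N & waits X n i].
have negB k m : mu.-negligible (B k m).
  have [[f fP]|nof] := pselect (exists f, forall n, Phi A k n (f n)); last first.
    apply: negligibleS (negligible_set0 mu) => X [f [fP _]].
    by apply: nof; exists f.
  have [e eio bad] := nf f (ex_intro _ k fP).
  have [h hP] := choice bad.
  (* An increasing sequence of bad elements of [Q e] beyond m. Since e is fixed, their blocks all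
     have length e + 2. *)
  pose s (j : nat) : nat := iter j h (h m).
  have sS j l : (j < l)%N -> (s j < s l)%N.
    elim: l => // l IH; rewrite ltnS leq_eqVlt => /predU1P[->|/IH sjl].
      by have [] := hP (s l).
    by apply: ltn_trans sjl _; have [] := hP (s l).
  have ms j : (m < s j)%N.
    have m0 : (m < s 0)%N by have [] := hP m.
    by case: j => // j; apply: ltn_trans m0 (sS _ _ _).
  have sP j : Q e (s j) /\ forall i, (s j < i)%N ->
      (i < f (pair_nat e (s j)))%N -> ~ Q e i.
    by case: j => [|j]; [have [] := hP m|have [] := hP (s j)].
  apply: negligibleS (@negligible_avoid_all_ones R e.+2
    (fun j => block (pair_nat e (s j))) _ _ _).
  - move=> X [g [gP gw]]; rewrite /mkset => j; apply/negP => Xj.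
    have [Qj nj] := sP j.
    (* The threshold m concerns the number <e, s j>, which is at least [s j]. Ones on this block
       would force an element of [Q e] after [s j] and below f, against badness. *)
    have [i] := gw (pair_nat e (s j)) (leq_trans (ms j) (leq_pair_nat _ _)).
    have -> : g (pair_nat e (s j)) = f (pair_nat e (s j)).
      have [c ce cg] := gP (pair_nat e (s j)).
      have [d de df] := fP (pair_nat e (s j)).
      by apply: eval_inj cg _; rewrite (encode_inj (etrans ce (esym de))).
    by move=> fi; rewrite /waits !pairE Qj Xj /= => /andP[ji /nj]; apply.
  - by move=> j; exact: uniq_block.
  - by move=> j; rewrite size_block fst_pair.
  - move=> j l i ij il; have [_ ] := pair_nat_inj (mem_block ij il).
    by case: (ltngtP j l) => // [/sS|/sS] + sjl; rewrite sjl ltnn.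
have [t tP] := waits_total.
set U := \bigcup_e _ in tP.
have mU : measurable U.
  by apply: bigcupT_measurable => e; exact: measurable_all_ones.
have muU : (mu U <= (2^-1)%:E)%E.
  apply: fair_coin_all_ones_bigcup => e; first exact: uniq_block.
  by rewrite size_block fst_pair.
have nU : mu.-negligible (~` U).
  apply: negligibleS (negligibleU ae_domA
    (negligible_bigcup (fun k => negligible_bigcup (negB k)))).
  move=> X /= /tP Xt; have [dX|] := pselect (forall g : nat -> nat,
    computable_in X g ->
    exists2 f : nat -> nat, computable_in A f & dominates f g);
    last by left.
  right.
  have [f [k fk] [m fm]] := dX _ (computable_ex_minn Xt (computable_waits X)).
  exists k => //; exists m => //; exists f; split=> // n /fm gn.
  exists (ex_minn (Xt n)) => //.
  by case: ex_minnP.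
have : mu (~` U) = 0%E by apply: measure_negligible nU; exact: measurableC.
rewrite probability_setC// => /eqP.
rewrite sube_eq ?fin_num_measure// ?add0e => /eqP U1.
by move: muU; rewrite -U1 lee_fin; lra.
Qed.

End Domination.

Theorem theorem5p3 (R : realType) (A : nat -> bool) :
  ae_dominating R A -> turing_le A (jump emptyset) ->
  turing_equiv (jump A) (jump (jump emptyset)).
Proof.
move=> domA A0; split; first exact: jump_turing_le.
have cQ X (e s : nat -> nat) := @computable_stage_fails X e s.
(* By [jump_jumpP], e lies outside 0'' exactly when [stage_fails e] holds infinitely often. *)
have [f fA fP] := @exists_bound R A stage_fails
  (fun X => cQ X _ _ (computable_fst (computable_id X))
     (computable_snd (computable_id X))) domA.
(* Here x codes a pair <e, w>: [next] finds a failure t from w on, and [next_f] one with no further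
   failure after t and below f(<e, t>). *)
pose next (x t : nat) := (snd_nat x <= t)%N && stage_fails (fst_nat x) t.
pose next_f (x t : nat) := next x t && all
  (fun i => ~~ ((t < i)%N && stage_fails (fst_nat x) i))
  (iota 0 (f (pair_nat (fst_nat x) t))).
have cnext : computable_in A (fun n => next (fst_nat n) (snd_nat n)).
  by rewrite /next; computable; apply: cQ; computable.
have cnext_f : computable_in A (fun n => next_f (fst_nat n) (snd_nat n)).
  rewrite /next_f; computable.
  apply: (@computable_all_iota A (fun n i =>
    ~~ ((snd_nat n < i)%N && stage_fails (fst_nat (fst_nat n)) i)) id);
    computable; first by apply: cQ; computable.
  by apply: (computable_comp fA); computable.
have {cnext} := exists_turing_le_jump cnext.
have {cnext_f} := exists_turing_le_jump cnext_f.
set N2 := fun x => `[< exists t, next_f x t >].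
set N1 := fun x => `[< exists t, next x t >] => cN2 cN1.
(* A witness decides e: either no failure occurs from w on, so e is in 0'', or w fails and each
   later failure has another after it below f, so e is not. Both alternatives are decidable in
   A'. *)
pose found (e w : nat) := ~~ N1 (pair_nat e w) ||
  (stage_fails e w && ~~ N2 (pair_nat e w)).
have notP e w : ~~ N1 (pair_nat e w) -> jump (jump emptyset) e.
  move=> /asboolP h; apply/jump_jumpP; exists w => t wt.
  by apply/negP => Qt; apply: h; exists t; rewrite /next !pairE wt.
have inP e w : stage_fails e w && ~~ N2 (pair_nat e w) ->
    ~~ jump (jump emptyset) e.
  move=> /andP[Qw /asboolP nN2]; apply/negP => /jump_jumpP[v vP].
  have later t : (w <= t)%N -> stage_fails e t ->
      exists2 i, (t < i)%N & stage_fails e i.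
    move=> wt Qt; apply: contrapT => ni; apply: nN2; exists t.
    rewrite /next_f /next !pairE wt Qt /=; apply/allP => i _.
    by apply/negP => /andP[ti Qi]; apply: ni; exists i.
  have [t [vt wt Qt]] : exists t, [/\ (v <= t)%N, (w <= t)%N & stage_fails e t].
    elim: v {vP} => [|v [t [vt wt Qt]]]; first by exists w.
    have [i ti Qi] := later t wt Qt.
    exists i; split=> //; first exact: leq_ltn_trans vt ti.
    exact: leq_trans wt (ltnW ti).
  by have := vP t vt; rewrite Qt.
have exfound e : exists w, found e w.
  have [/jump_jumpP[w wP]|ne] := boolP (jump (jump emptyset) e).
    exists w; rewrite /found; apply/orP; left; apply/asboolP => -[t].
    by rewrite /next !pairE => /andP[/wP/negbTE->].
  have eio : infinitely_often stage_fails e.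
    move=> w; apply: contrapT => nt; case/negP: ne; apply/jump_jumpP.
    exists w.+1 => t wt; apply/negP => Qt; apply: nt; by exists t.
  (* The bound f is correct only beyond w, so the witness is a failure u past w. *)
  have [w wP] := fP e eio; have [u wu Qu] := eio w.
  exists u; rewrite /found Qu /=; apply/orP; right; apply/asboolP => -[t].
  rewrite /next_f /next !pairE => /andP[/andP[ut Qt] /allP h].
  have [i [ti fi Qi]] := wP t (leq_trans wu ut) Qt.
  by have := h i; rewrite mem_iota /= add0n fi ti Qi => /(_ isT).
have cfound : computable_in (jump A)
    (fun n => found (fst_nat n) (snd_nat n)).
  rewrite /found; computable.
  - by apply: (computable_comp cN1); computable.
  - by apply: cQ; computable.
  - by apply: (computable_comp cN2); computable.
(* A' searches for the least witness; [N1] there tells which alternative holds, as [notP] and [inP]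
   exclude each other. *)
have cw := computable_ex_minn exfound cfound.
have : computable_in (jump A)
    (fun e => ~~ N1 (pair_nat e (ex_minn (exfound e)))).
  by computable; apply: (computable_comp cN1); computable.
congr computable_in; apply: funext => e; congr nat_of_bool.
case: ex_minnP => w /orP[n1 _|q _].
  by rewrite n1 (notP _ _ n1).
rewrite (negbTE (inP _ _ q)); apply/negbTE/negP => n1.
by have := notP _ _ n1; rewrite (negbTE (inP _ _ q)).
Qed.
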